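(* $$\dim_H \left\{ x \in \mathbb{I} : \limsup_{n\to\infty} \frac{\log d_n(x)-n}{\sqrt{2n\log\log n}} \neq 1 \ \text{ or } \ \liminf_{n\to\infty} \frac{\log d_n(x)-n}{\sqrt{2n\log\log n}} \neq -1 \right\} = 1,$$ where $\mathbb{I}$ is the set of irrational numbers in $(0,1]$.
   Context: Pierce expansion digits: for $x \in (0,1]$ put $d_1(x) := \lfloor 1/x \rfloor$ and $T(x) := 1 - d_1(x)x$, and for $k \in \mathbb{N}$ put $d_k(x) := d_1(T^{k-1}(x))$ provided $T^{k-1}(x) \neq 0$. All digits $d_k(x)$, $k \in \mathbb{N}=\{1,2,\dots\}$, are defined exactly when $x$ is irrational, and then they form a strictly increasing sequence of positive integers. $\log$ is the natural logarithm, and $\dim_H$ is the Hausdorff dimension. *)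

(* Defs.v *)
From HB Require Import structures.
From mathcomp Require Import all_boot all_order all_algebra.
From mathcomp Require Import all_classical all_reals all_analysis.

Set Implicit Arguments.
Unset Strict Implicit.
Unset Printing Implicit Defensive.

Import Order.TTheory GRing.Theory Num.Theory.
Import numFieldNormedType.Exports.

Local Open Scope classical_set_scope.
Local Open Scope ring_scope.

Definition pierce_d1 (R : realType) (x : R) : int := Num.floor (1 / x).

Definition pierce_T (R : realType) (x : R) : R := 1 - (pierce_d1 x)%:~R * x.

(* Meaningful for 1 <= k as long as iter k.-1 (@pierce_T R) x != 0, which always
   holds when x is an irrational number of (0, 1]; a junk value otherwise. *)
Definition pierce_digit (R : realType) (k : nat) (x : R) : int :=
  pierce_d1 (iter k.-1 (@pierce_T R) x).

(* Since ln y = 0 for y <= 0, Num.sqrt y = 0 for y <= 0 and z / 0 = 0, the value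
   is 0 for n <= 2, where the quotient is undefined; upper and lower limits as
   n tends to infinity do not depend on these terms. *)
Definition pierce_lil (R : realType) (x : R) (n : nat) : R :=
  (ln (pierce_digit n x)%:~R - n%:R) / Num.sqrt (2 * n%:R * ln (ln n%:R)).

Definition irrational_unit (R : realType) : set R :=
  [set x : R | 0 < x <= 1 /\ irrational x].

Local Open Scope ereal_scope.

(* The maximum with 0 gives the empty set diameter 0. *)
Definition diameter (R : realType) (A : set R) : \bar R :=
  maxe 0 (ereal_sup [set `|p.1 - p.2|%:E | p in A `*` A]).

Definition delta_cover (R : realType) (delta : R) (A : set R)
    (U : nat -> set R) : Prop :=
  A `<=` \bigcup_i U i /\ forall i, diameter (U i) <= delta%:E.

(* Empty sets of the cover contribute 0, also for s = 0, so that finite covers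
   are included; a nonempty set of diameter 0 contributes 0 `^ 0 = 1 for s = 0. *)
Definition hausdorff_premeasure (R : realType) (s delta : R) (A : set R) :
    \bar R :=
  ereal_inf [set \sum_(0 <= i <oo | U i != set0) poweR (diameter (U i)) s
            | U in delta_cover delta A].

Definition hausdorff_measure (R : realType) (s : R) (A : set R) : \bar R :=
  ereal_sup [set hausdorff_premeasure s delta A
            | delta in [set delta : R | (0 < delta)%R]].

Definition hausdorff_dim (R : realType) (A : set R) : \bar R :=
  ereal_inf [set s%:E
            | s in [set s : R | (0 <= s)%R /\ hausdorff_measure s A = 0]].

(* Main.v *)
Require Import Defs.
From HB Require Import structures.
From mathcomp Require Import all_boot all_order all_algebra.
From mathcomp Require Import all_classical all_reals all_analysis.
From mathcomp Require Import ring lra.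

(** A Pierce expansion leaves the law of the iterated logarithm as soon as its
    digits satisfy [d_(n+1) <= 2 d_n]: then [ln d_n <= n ln 2 + O(1)], and as
    [ln 2 < 1] the quotient in the statement is eventually nonpositive, so its
    upper limit cannot be [1].  It remains to see that numbers of this kind
    already fill dimension one.

    A digit [d] has exactly [d] admissible successors [d+1, ..., 2d], so
    choosing the successors uniformly codes [[0, 1)] into such numbers: write
    [u] in the mixed base given by the digits themselves ([greedy]) and let
    [code] be the number with these digits.  Prescribing [n] digits cuts out an
    interval of length about [1 / (d_1 ... d_n d_n)] of numbers, and an interval
    of length [1 / (d_0 ... d_(n-1))] of parameters, where [d_0] is the start of
    the recursion.  The quotient of the two is at most exponential in [n], while
    the lengths decay superexponentially; hence the inverse of [code] is Hoelder
    of every exponent [s < 1].  This is [code_holder], proved by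
    renormalisation.  If the first digits differ, the two codes are far apart
    ([code_separation]), because the missing successors [> 2d] leave a gap in
    every interval, always on the same side.  If they agree, removing them
    multiplies the parameter distance by [d] and the distance of the codes by
    the new digit; the loss is the constant [4 `^ s], which the factor
    [d `^ (1 - s)] absorbs when the starting digit is large.

    A cover of the coded set therefore pulls back to a cover of [[0, 1)] by
    intervals of length [O(diam `^ s)], and the Lebesgue measure of [[0, 1)]
    bounds the [s]-dimensional sums from below ([hausdorff_measure_neq0]).  The
    upper bound [1] for the dimension holds for every subset of [[0, 1]]
    ([hausdorff_measure_gt1_eq0]). *)

Set Implicit Arguments.
Unset Strict Implicit.
Unset Printing Implicit Defensive.

Import Order.TTheory GRing.Theory Num.Theory.
Import numFieldNormedType.Exports.

Local Open Scope classical_set_scope.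
Local Open Scope ring_scope.

(** * Hausdorff measure of subsets of the unit interval *)

Section Hausdorff.
Variable R : realType.
Local Open Scope ereal_scope.

Lemma diameter_ge0 (A : set R) : 0 <= diameter A.
Proof. by rewrite /diameter le_max lexx. Qed.

Lemma le_diameter (A : set R) x y : A x -> A y -> `|x - y|%:E <= diameter A.
Proof.
move=> Ax Ay; rewrite /diameter le_max; apply/orP; right.
by apply: ereal_sup_ubound; exists (x, y).
Qed.

Lemma diameter_le (A : set R) (b : \bar R) : 0 <= b ->
  (forall x y, A x -> A y -> `|x - y|%:E <= b) -> diameter A <= b.
Proof.
move=> b0 h; rewrite /diameter ge_max b0/=.
by apply: ge_ereal_sup => _ [[x y] [/= Ax Ay] <-]; exact: h.
Qed.

(** [M] intervals of length [1 / M] contribute about [M `^ (1 - s)], which is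
    arbitrarily small for [s > 1]. *)
Lemma hausdorff_measure_gt1_eq0 (s : R) (A : set R) : (1 < s)%R ->
  A `<=` `[0%R, 1%R] -> hausdorff_measure s A = 0.
Proof.
move=> s1 A01; have s10 : (0 < s - 1)%R by rewrite subr_gt0.
apply/eqP; rewrite eq_le; apply/andP; split; last first.
  apply: (@le_trans _ _ (hausdorff_premeasure s 1 A)).
    apply: le_ereal_inf_tmp => _ [U _ <-].
    by apply: nneseries_ge0 => i _ _; exact: poweR_ge0.
  by apply: ereal_sup_ubound; exists 1%R => //=.
apply: ge_ereal_sup => _ [delta /= delta0 <-].
apply/lee_addgt0Pr => e e0; rewrite add0e.
(* M >= b makes the pieces shorter than delta and 2 M `^ (1 - s) <= e. *)
pose b : R := (Num.max delta^-1 ((2 / e) `^ (s - 1)^-1))%R.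
pose M := (Num.truncn b).+1.
have Mb : (b < M%:R)%R by exact: truncnS_gt.
have M0 : (0 < M%:R :> R)%R by rewrite ltr0n.
have Mdelta : (M%:R^-1 <= delta)%R.
  rewrite -[leRHS]invrK lef_pV2 ?posrE ?invr_gt0//.
  by apply: le_trans (ltW Mb); rewrite le_max lexx.
have Me : (2 / e <= M%:R `^ (s - 1))%R.
  have e2 : (0 <= 2 / e)%R by rewrite divr_ge0// ltW.
  have -> : (2 / e = ((2 / e) `^ (s - 1)^-1) `^ (s - 1))%R.
    by rewrite -powRrM mulVf ?gt_eqF// powRr1.
  apply: ge0_ler_powR; rewrite ?nnegrE ?powR_ge0 ?ltW//.
  by apply: le_lt_trans Mb; rewrite le_max lexx orbT.
(* M + 1 pieces, so that the right endpoint 1 is covered as well. *)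
pose U (i : nat) : set R :=
  if (i <= M)%N then `[(i%:R / M%:R)%R, (i.+1%:R / M%:R)%R]%classic else set0.
have diamU i : diameter (U i) <= (M%:R^-1)%:E.
  apply: diameter_le; first by rewrite lee_fin invr_ge0.
  rewrite /U; case: ifP => // _ x y /=; rewrite !in_itv/= lee_fin.
  rewrite -natr1 mulrDl mul1r => /andP[x0 x1] /andP[y0 y1].
  by rewrite ler_norml; lra.
have coverU : delta_cover delta A U.
  split=> [x Ax|i]; last by rewrite (le_trans (diamU i))// lee_fin.
  have := A01 _ Ax; rewrite /= in_itv/= => /andP[x0 x1].
  have Mx0 : (0 <= M%:R * x)%R by rewrite mulr_ge0.
  exists (Num.truncn (M%:R * x)) => //; rewrite /U.
  rewrite truncn_le_nat (le_lt_trans (_ : _ <= M%:R))%R ?ltr_nat//; last first.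
    by rewrite -[leRHS]mulr1 ler_wpM2l.
  have /andP[h1 h2] := truncn_itv Mx0.
  by rewrite /= in_itv/= ler_pdivrMr// ler_pdivlMr// (mulrC x) h1 ltW.
apply: (le_trans (ereal_inf_lbound (ex_intro2 _ _ U coverU erefl))).
rewrite eseries_mkcond (nneseries_split _ M.+1); last first.
  by move=> i _; case: ifP => // _; exact: poweR_ge0.
rewrite [X in _ + X]eseries0 ?adde0; last first.
  move=> i Mi _; rewrite /U leqNgt; rewrite add0n in Mi; rewrite Mi/=.
  by rewrite eqxx.
rewrite add0n big_mkord.
apply: (@le_trans _ _ (\sum_(i < M.+1) (M%:R^-1 `^ s)%R%:E)).
  apply: lee_sum => i _; case: ifP => _; last by rewrite lee_fin powR_ge0.
  rewrite -poweR_EFin; apply: gt0_ler_poweR => //.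
  - by apply: ltW; apply: lt_trans s1.
  - by rewrite in_itv/= diameter_ge0 leey.
  - by rewrite in_itv/= lee_fin invr_ge0 ler0n leey.
rewrite sumEFin lee_fin sumr_const card_ord -[leLHS]mulr_natr.
have -> : (M%:R^-1 `^ s = (M%:R * M%:R `^ (s - 1))^-1 :> R)%R.
  rewrite mulr_powRB1//; last by apply: lt_trans s1.
  by rewrite -powR_inv1// -powRrM mulN1r powRN.
rewrite ler_pdivrMl; last by rewrite mulr_gt0// powR_gt0.
rewrite ler_pdivrMr// in Me.
have M2 : (M.+1%:R <= 2 * M%:R :> R)%R.
  by rewrite -natrM ler_nat mul2n -addnn -addn1 leq_add2l.
by apply: (le_trans M2); nra.
Qed.

(** A map whose inverse is Hoelder of exponent [s] carries the Lebesgue measure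
    of [[0, 1)] to a mass distribution charging a set of diameter [r] at most
    [2 C r `^ s], so that [s]-dimensional sums of covers stay away from [0]. *)
Lemma hausdorff_measure_neq0 (A : set R) (f : R -> R) (s C : R) :
  (0 <= s)%R -> (0 <= C)%R ->
  (forall u, (0 <= u < 1)%R -> A (f u)) ->
  (forall u v, (0 <= u < 1)%R -> (0 <= v < 1)%R ->
    (`|u - v| <= C * `|f u - f v| `^ s)%R) ->
  hausdorff_measure s A != 0.
Proof.
move=> s0 C0 fA fC; apply/eqP => HA.
have C20 : (0 < 2 * C + 1)%R by lra.
have : hausdorff_premeasure s 1 A < ((2 * C + 1)^-1)%:E.
  apply: (@le_lt_trans _ _ 0); last by rewrite lte_fin invr_gt0.
  by rewrite -HA; apply: ereal_sup_ubound; exists 1%R => //=.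
move=> /ereal_inf_lt[_ [U [AU U1] <-]] sumU.
pose r i := (C * fine (diameter (U i)) `^ s)%R.
have diamE i : diameter (U i) = (fine (diameter (U i)))%:E.
  rewrite fineK// ge0_fin_numE ?diameter_ge0//.
  by apply: le_lt_trans (U1 i) _; rewrite ltry.
have r0 i : (0 <= r i)%R by rewrite mulr_ge0// powR_ge0.
(* K i is an interval centred at one parameter sent into U i; by the Hoelder
   bound it contains all of them and, unlike the set of these parameters, it
   is measurable for every f. *)
have [K [mK KU K0]] : exists K : nat -> set R, [/\
    (forall i, measurable (K i)),
    (forall i u, (0 <= u < 1)%R -> U i (f u) -> K i u) &
    (forall i, lebesgue_measure (K i) <=
       if U i != set0 then (2 * r i)%:E else 0)].
  suff /choice[K hK] : forall i, exists K : set R, [/\ measurable K,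
      (forall u, (0 <= u < 1)%R -> U i (f u) -> K u) &
      lebesgue_measure K <= if U i != set0 then (2 * r i)%:E else 0].
    by exists K; split => i; have [] := hK i.
  move=> i.
  have [[u [u01 Uu]]|noU] := pselect (exists u, (0 <= u < 1)%R /\ U i (f u)).
    exists `[(u - r i)%R, (u + r i)%R]%classic; split => //.
    - move=> v v01 Uv /=; rewrite in_itv/=.
      have : (`|u - v| <= r i)%R.
        apply: (le_trans (fC _ _ u01 v01)); rewrite ler_wpM2l//.
        apply: ge0_ler_powR; rewrite ?nnegrE ?fine_ge0 ?diameter_ge0//.
        by rewrite -lee_fin -diamE le_diameter.
      by rewrite ler_norml; lra.
    - have -> : U i != set0 by apply/set0P; exists (f u).
      rewrite lebesgue_measure_itv/=; case: ifP => _.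
        by rewrite -EFinD lee_fin; lra.
      by rewrite lee_fin mulr_ge0.
  exists set0; split=> //; first by move=> u u01 Uu; apply: noU; exists u.
  by rewrite measure0; case: ifP => // _; rewrite lee_fin mulr_ge0.
have : lebesgue_measure (`[0%R, 1%R[%classic : set R) <=
    \sum_(0 <= i <oo) lebesgue_measure (K i).
  apply: measure_sigma_subadditive => // u /=; rewrite in_itv/= => u01.
  have [i _ Ui] := AU _ (fA _ u01); exists i => //; exact: KU.
rewrite lebesgue_measure_itv/= lte_fin ltr01 oppr0 adde0 => le1.
have : (1%R%:E : \bar R) <= (2 * C)%:E *
   \sum_(0 <= i <oo | U i != set0) poweR (diameter (U i)) s.
  rewrite -nneseriesZl; last by move=> i _; exact: poweR_ge0.
  rewrite eseries_mkcond; apply: (le_trans le1).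
  apply: lee_nneseries => // i _; apply: (le_trans (K0 i)).
  by case: ifP => // _; rewrite diamE poweR_EFin -EFinM /r mulrA.
apply/negP; rewrite -ltNge.
apply: (@le_lt_trans _ _ ((2 * C)%:E * ((2 * C + 1)^-1)%:E)).
  by apply: lee_wpmul2l; [rewrite lee_fin mulr_ge0|exact: ltW].
by rewrite -EFinM lte_fin ltr_pdivrMr//; lra.
Qed.

End Hausdorff.

(** * Coding by Pierce expansions with digits that at most double *)

Section Coding.
Variable R : realType.
Implicit Types p q : nat * R.

(** A pair [(d, u)] stands for the last digit [d] and the rest [u] of the
    parameter; [u] is cut into [d] equal parts, one for each of the successors
    [d+1, ..., 2d]. *)
Definition greedy p : nat * R :=
  ((p.1 + Num.truncn (p.1%:R * p.2)).+1,
   p.1%:R * p.2 - (Num.truncn (p.1%:R * p.2))%:R).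

Definition state p := (0 < p.1)%N && (0 <= p.2 < 1).

Lemma greedy_truncn p : state p ->
  (Num.truncn (p.1%:R * p.2))%:R <= p.1%:R * p.2
    < (Num.truncn (p.1%:R * p.2))%:R + 1.
Proof.
case/and3P=> d0 u0 u1.
have := @truncn_itv R (p.1%:R * p.2); rewrite -natr1; apply.
exact: mulr_ge0.
Qed.

Lemma state_greedy p : state p -> state (greedy p).
Proof.
by move=> /greedy_truncn /andP[h1 h2]; rewrite /state /= subr_ge0 h1 ltrBlDl.
Qed.

Lemma greedy_gt p : (p.1 < (greedy p).1)%N.
Proof. by rewrite /= ltnS leq_addr. Qed.

Lemma greedy_le p : state p -> ((greedy p).1 <= p.1 + p.1)%N.
Proof.
move=> vp; have /andP[h1 _] := greedy_truncn vp.
move: vp => /and3P[d0 _ u1]; rewrite /= -addnS leq_add2l -(ltr_nat R).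
apply: (le_lt_trans h1).
by rewrite -[ltRHS]mulr1 ltr_pM2l// ltr0n.
Qed.

Lemma state_iter n p : state p -> state (iter n greedy p).
Proof. by move=> vp; elim: n => // n; exact: state_greedy. Qed.

(** Truncations of the Pierce expansion
    [1/d_1 - 1/(d_1 d_2) + 1/(d_1 d_2 d_3) - ...] whose digits are chosen by
    [greedy]. *)
Fixpoint convergent m p : R :=
  if m is m'.+1 then (1 - convergent m' (greedy p)) / (greedy p).1%:R else 0.

Lemma convergent_itv m p : state p -> 0 <= convergent m p <= (p.1.+1%:R)^-1.
Proof.
elim: m p => [|m IH] p vp; first by rewrite lexx invr_ge0 ler0n.
have /andP[h0 h1] := IH _ (state_greedy vp).
have sp : 0 < (greedy p).1%:R :> R by rewrite ltr0n.
have le1 : convergent m (greedy p) <= 1.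
  by apply: (le_trans h1); rewrite invf_le1 ?ltr0n// ler1n.
rewrite [convergent _ _]/=; apply/andP; split.
  by rewrite divr_ge0// subr_ge0.
apply: (@le_trans _ _ ((greedy p).1%:R)^-1).
  by rewrite ler_pdivrMr// mulVf ?gt_eqF// gerBl.
by rewrite lef_pV2 ?posrE ?ltr0n// ler_nat greedy_gt.
Qed.

(** Digits produced from a positive one are at least [2], so each level
    contracts by a factor at least [2]. *)
Lemma convergent_step m p : state p ->
  `|convergent m.+1 p - convergent m p| <= (2^-1) ^+ m.
Proof.
elim: m p => [|m IH] p vp.
  have /andP[h0 h1] := convergent_itv 1 vp.
  rewrite expr0 [convergent 0 _]/= subr0 ger0_norm// (le_trans h1)//.
  by rewrite invf_le1 ?ltr0n// ler1n.
have := IH _ (state_greedy vp).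
set a := convergent m.+1 _; set b := convergent m _ => ab.
have -> : convergent m.+2 p - convergent m.+1 p = (b - a) / (greedy p).1%:R.
  rewrite -[convergent m.+2 p]/((1 - a) / _).
  rewrite -[convergent m.+1 p]/((1 - b) / _).
  by rewrite -mulrBl; congr (_ * _); ring.
rewrite normrM distrC exprSr ler_pM// ger0_norm ?invr_ge0//.
rewrite lef_pV2 ?posrE ?ltr0n// ler_nat.
by case/andP: vp => d0 _; exact: leq_trans (greedy_gt p).
Qed.

Definition code p : R := limn (convergent ^~ p).

Lemma convergent_cvg p : state p -> (convergent ^~ p) @ \oo --> code p.
Proof.
move=> vp; suff : cvgn (series (telescope (convergent ^~ p))).
  rewrite telescopeK => h.
  rewrite /code (_ : convergent ^~ p =
    (fun m => convergent m p - convergent 0 p) \+ cst (convergent 0 p)).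
    by apply: is_cvgD; [exact: h|exact: is_cvg_cst].
  by apply/funext => m /=; rewrite subrK.
apply: normed_cvg.
apply: (@series_le_cvg _ _ (geometric 1 2^-1)).
- by move=> n; exact: normr_ge0.
- by move=> n; rewrite /= mul1r exprn_ge0.
- by move=> n; rewrite /= mul1r convergent_step.
- by apply: is_cvg_geometric_series; rewrite ger0_norm// invf_lt1// ltr1n.
Qed.

(** The relation [T x = 1 - d_1 x] solved for [x]; all later facts about [code]
    come from it and the crude bounds below. *)
Lemma codeE p : state p -> code p = (1 - code (greedy p)) / (greedy p).1%:R.
Proof.
move=> vp; apply/cvg_lim => //.
rewrite -cvg_shiftS /=; apply: cvgM; last exact: cvg_cst.
by apply: cvgB; [exact: cvg_cst|exact/convergent_cvg/state_greedy].
Qed.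

Lemma code_itv_weak p : state p -> 0 <= code p <= (p.1.+1%:R)^-1.
Proof.
move=> vp; have h := convergent_cvg vp; apply/andP; split.
  apply: (limr_ge h); apply: nearW => m; by case/andP: (convergent_itv m vp).
apply: (limr_le h); apply: nearW => m; by case/andP: (convergent_itv m vp).
Qed.

Lemma code_gt0 p : state p -> 0 < code p.
Proof.
move=> vp; have /andP[_ h] := code_itv_weak (state_greedy vp).
rewrite codeE// divr_gt0 ?ltr0n// subr_gt0 (le_lt_trans h)//.
by rewrite invf_lt1 ?ltr0n// ltr1n.
Qed.

Lemma code_lt_digit p : state p -> code p < ((greedy p).1%:R)^-1.
Proof.
move=> vp; have h := code_gt0 (state_greedy vp).
by rewrite codeE// ltr_pdivrMr ?ltr0n// mulVf ?gt_eqF ?ltr0n// gtrBl.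
Qed.

Lemma code_lt p : state p -> code p < (p.1.+1%:R)^-1.
Proof.
move=> vp; apply: (lt_le_trans (code_lt_digit vp)).
by rewrite lef_pV2 ?posrE ?ltr0n// ler_nat greedy_gt.
Qed.

(** With [code_lt_digit], this says that the greedy successor is the first
    Pierce digit of [code p]. *)
Lemma code_gt_digit p : state p -> ((greedy p).1.+1%:R)^-1 < code p.
Proof.
move=> vp; have := code_lt (state_greedy vp).
rewrite [code p]codeE//; set e := (greedy p).1; set c := code _ => h.
have e0 : 0 < e%:R :> R by rewrite ltr0n.
rewrite ltr_pdivlMr//.
have -> : (e.+1%:R)^-1 * e%:R = 1 - (e.+1%:R)^-1 :> R.
  by rewrite -natr1; field; rewrite natr1 gt_eqF// ltr0n.
by rewrite ltrD2l ltrN2.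
Qed.

(** The next digit is at most [2 d], which leaves the gap [(0, 1 / (2 d + 1)]]
    free of codes: this is the source of separation. *)
Lemma code_gt p : state p -> ((p.1 + p.1).+1%:R)^-1 < code p.
Proof.
move=> vp; apply: (le_lt_trans _ (code_gt_digit vp)).
by rewrite lef_pV2 ?posrE ?ltr0n// ler_nat ltnS greedy_le.
Qed.

(** * Digits and irrationality of the coded numbers *)

Lemma pierce_d1_code p : state p -> pierce_d1 (code p) = (greedy p).1%:Z.
Proof.
move=> vp; apply: floor_def; have c0 := code_gt0 vp.
rewrite div1r intrD -pmulrn natr1.
rewrite -[leLHS]invrK -[ltRHS]invrK lef_pV2 ?ltf_pV2 ?posrE ?invr_gt0 ?ltr0n//.
by rewrite ltW ?code_lt_digit//= code_gt_digit.
Qed.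

Lemma pierce_T_code p : state p -> pierce_T (code p) = code (greedy p).
Proof.
move=> vp; rewrite /pierce_T pierce_d1_code// -pmulrn codeE//.
by rewrite mulrC divfK ?gt_eqF ?ltr0n// subKr.
Qed.

Lemma iter_pierce_T_code n p : state p ->
  iter n (@pierce_T R) (code p) = code (iter n greedy p).
Proof.
move=> vp; elim: n => //= n ->.
by rewrite pierce_T_code// state_iter.
Qed.

Lemma pierce_digit_code n p : state p ->
  pierce_digit n.+1 (code p) = (iter n.+1 greedy p).1%:Z.
Proof.
move=> vp; rewrite /pierce_digit [n.+1.-1]/= iter_pierce_T_code//.
by rewrite pierce_d1_code// state_iter.
Qed.

(** On [a / b] the Pierce map acts on numerators as [a |-> b - d_1 a], which is
    [b] mod [a], hence smaller than [a]; a positive orbit would descend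
    forever. *)
Lemma code_neq_frac (a b : nat) p : state p -> code p != a%:R / b%:R.
Proof.
elim/ltn_ind: a p => a IH p vp; apply/eqP => cE.
have c0 := code_gt0 vp.
have b0 : 0 < b%:R :> R.
  rewrite lt0r ler0n andbT; apply: contraTneq c0 => b0.
  by rewrite cE b0 invr0 mulr0 ltxx.
set e := (greedy p).1.
have cS : code (greedy p) = 1 - e%:R * (a%:R / b%:R).
  by rewrite -cE [code p]codeE// mulrC divfK ?gt_eqF ?ltr0n// subKr.
have lt1 : (e * a < b)%N.
  have := code_gt0 (state_greedy vp); rewrite cS subr_gt0 mulrA ltr_pdivrMr//.
  by rewrite mul1r -natrM ltr_nat.
have lt2 : (b - e * a < a)%N.
  rewrite (ltn_subLR _ (ltnW lt1)) -mulSnr.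
  have := code_gt_digit vp; rewrite cE ltr_pdivlMr// mulrC ltr_pdivrMr ?ltr0n//.
  by rewrite -natrM ltr_nat mulnC.
have /eqP := IH _ lt2 _ (state_greedy vp); apply.
rewrite cS (natrB _ (ltnW lt1)) natrM; field.
by rewrite gt_eqF.
Qed.

Lemma irrational_code p : state p -> irrational (code p).
Proof.
move=> vp /rationalP[[a|a] [b cE]].
  by have /eqP := code_neq_frac a b vp; apply; rewrite cE -pmulrn.
have := code_gt0 vp; rewrite cE ltNge; apply/negP; rewrite negbK.
by rewrite mulr_le0_ge0 ?invr_ge0// NegzE mulrNz oppr_le0 -pmulrn.
Qed.

Lemma irrational_unit_code p : state p -> irrational_unit (code p).
Proof.
move=> vp; split; last exact: irrational_code.
rewrite code_gt0//= ltW// (lt_le_trans (code_lt vp))//.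
by rewrite invf_le1 ?ltr0n// ler1n.
Qed.

Lemma iter_greedy_le n p : state p -> ((iter n greedy p).1 <= 2 ^ n * p.1)%N.
Proof.
move=> vp; elim: n => [|n IH]; first by rewrite mul1n.
apply: (leq_trans (greedy_le (state_iter n vp))).
by rewrite addnn -mul2n expnS -mulnA leq_mul2l.
Qed.

Lemma ln2_lt1 : ln 2 < 1 :> R.
Proof.
rewrite -ltr_expR lnK ?posrE//.
by have := @expR_gt1Dx R 1; rewrite oner_neq0 => /(_ isT).
Qed.

(** At level [n] the numerator [ln d_n - n] is at most
    [ln d - n (1 - ln 2)], where [d] is the starting digit. *)
Lemma limn_esup_pierce_lil_code p : state p ->
  (limn_esup (fun n => (pierce_lil (code p) n)%:E) <= 0)%E.
Proof.
move=> vp.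
have l2 : 0 < 1 - ln 2 :> R by rewrite subr_gt0 ln2_lt1.
have d0 : (0 < p.1)%N by case/andP: vp.
pose N := (Num.truncn (ln (p.1%:R : R) / (1 - ln 2))).+1.
rewrite /limn_esup limf_esupE.
apply: (@le_trans _ _ (ereal_sup
  ((fun n => (pierce_lil (code p) n)%:E) @` [set n | (N <= n)%N]))).
  by apply: ereal_inf_lbound; exists [set n | (N <= n)%N] => //; exists N.
apply: ge_ereal_sup => _ [n /= Nn <-]; rewrite lee_fin.
case: n Nn => // n Nn; rewrite /pierce_lil pierce_digit_code// -pmulrn.
rewrite mulr_le0_ge0 ?invr_ge0 ?sqrtr_ge0// subr_le0.
have e0 : (0 < (iter n.+1 greedy p).1)%N by case/andP: (state_iter n.+1 vp).
apply: (@le_trans _ _ (ln ((2 ^ n.+1 * p.1)%N%:R : R))).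
  rewrite ler_ln ?posrE ?ltr0n ?muln_gt0 ?expn_gt0//.
  by rewrite ler_nat iter_greedy_le.
rewrite natrM lnM ?posrE ?ltr0n ?expn_gt0// natrX lnXn//.
rewrite -lerBrDl (_ : _ - _ = n.+1%:R * (1 - ln 2)); last by ring.
rewrite -ler_pdivrMr//.
apply/ltW; apply: (lt_le_trans (truncnS_gt _)).
by rewrite ler_nat.
Qed.

(** * Hoelder continuity of the decoding *)

(** Different successors [k < l] of [d].  Codes decrease in the first digit: the
    code of [u] exceeds [1 / (k + 1)] while that of [v] is below [1 / (l + 1/2)]
    thanks to the gap, so even for neighbours the difference is of order
    [(l - k) / d^2].  The parameters are at most [2 (l - k) / d] apart. *)
Lemma code_separation (d : nat) (u v : R) : state (d, u) -> state (d, v) ->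
  ((greedy (d, u)).1 < (greedy (d, v)).1)%N ->
  `|u - v| <= 36 * (d%:R * `|code (d, u) - code (d, v)|).
Proof.
move=> vu vv kl.
have d0 : 1 <= d%:R :> R by case/andP: vu => d0 _; rewrite ler1n.
pose k : R := (greedy (d, u)).1%:R; pose l : R := (greedy (d, v)).1%:R.
have kE : k = d%:R + (Num.truncn (d%:R * u))%:R + 1.
  by rewrite /k -natrD natr1.
have lE : l = d%:R + (Num.truncn (d%:R * v))%:R + 1.
  by rewrite /l -natrD natr1.
have /andP[u1 u2] : _ <= d%:R * u < _ := greedy_truncn vu.
have /andP[v1 v2] : _ <= d%:R * v < _ := greedy_truncn vv.
rewrite [(d, u).1]/= [(d, u).2]/= in u1 u2.
rewrite [(d, v).1]/= [(d, v).2]/= in v1 v2.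
have kl1 : k + 1 <= l by rewrite /k /l natr1 ler_nat.
have l2 : l <= d%:R + d%:R by rewrite /l -natrD ler_nat; exact: (greedy_le vv).
have dk : d%:R + 1 <= k by rewrite natr1 ler_nat; exact: (greedy_gt (d, u)).
have cu : (k + 1)^-1 < code (d, u) by rewrite natr1 code_gt_digit.
have cv : code (d, v) < (l + 2^-1)^-1.
  have := code_gt (state_greedy vv).
  rewrite [code (d, v)]codeE// -natr1 natrD -/l.
  have l0 : 0 < l by lra.
  move=> h; rewrite ltr_pdivrMr//.
  have -> : (l + 2^-1)^-1 * l = 1 - (l + l + 1)^-1 by field; lra.
  by rewrite ltrD2l ltrN2.
have uv : d%:R * (v - u) <= 2 * (l - k) by lra.
have cuv : (l - k) / (18 * d%:R ^+ 2) <= code (d, u) - code (d, v).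
  apply: (@le_trans _ _ ((k + 1)^-1 - (l + 2^-1)^-1)); last by lra.
  have -> : (k + 1)^-1 - (l + 2^-1)^-1
      = (l - k - 2^-1) / ((k + 1) * (l + 2^-1)).
    by field; lra.
  have p1 : 0 < (k + 1) * (l + 2^-1) by nra.
  rewrite ler_pdivrMr; last by nra.
  rewrite mulrAC ler_pdivlMr//.
  have b1 : (k + 1) * (l + 2^-1) <= 9 * d%:R ^+ 2 by nra.
  by nra.
have dif0 : 0 < code (d, u) - code (d, v).
  by apply: lt_le_trans cuv; apply: divr_gt0; nra.
have vu0 : 0 < v - u.
  have : d%:R * u < d%:R * v by lra.
  by rewrite ltr_pM2l ?subr_gt0//; lra.
rewrite distrC (gtr0_norm vu0) (gtr0_norm dif0).
rewrite -(@ler_pM2l _ d%:R); last by lra.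
apply: (le_trans uv).
move: cuv; rewrite ler_pdivrMr; last by nra.
set c := code _ - _; nra.
Qed.

(** The quantity [d * distance of codes] is the distance relative to the scale
    [1 / d] of all codes from [d]; it is at most [1], which makes the linear
    bound of [code_separation] imply the Hoelder one.  Common digits are removed
    one at a time, a process that ends since each removal at least doubles the
    distance of the parameters, which is less than [1]. *)
Lemma code_holder (s : R) (d : nat) (u v : R) : 0 <= s < 1 -> (1 < d)%N ->
  4 `^ (s / (1 - s)) <= d%:R -> state (d, u) -> state (d, v) ->
  `|u - v| <= 36 * (d%:R * `|code (d, u) - code (d, v)|) `^ s.
Proof.
move=> /andP[s0 s1] d2 dD vu vv.
have [->|uv] := eqVneq u v.
  by rewrite subrr normr0 mulr_ge0// powR_ge0.
have [n] : exists n : nat, (2^-1) ^+ n <= `|u - v|.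
  have uv0 : 0 < `|u - v| by rewrite normr_gt0 subr_eq0.
  have h2 : `|2^-1 : R| < 1 by rewrite ger0_norm// invf_lt1// ltr1n.
  have /cvgrPdist_lt/(_ _ uv0)[n _ /(_ n)/=] := cvg_geometric 1 h2.
  rewrite leqnn => /(_ isT); rewrite sub0r normrN mul1r ger0_norm// => /ltW.
  by exists n.
elim: n d u v d2 dD vu vv {uv} => [|n IH] d u v d2 dD vu vv hn.
  move: vu vv => /and3P[_ /= u0 u1] /and3P[_ /= v0 v1].
  by move: hn; rewrite expr0 leNgt ltr_norml; lra.
have d1 : 1 <= d%:R :> R by case/andP: vu => d0 _; rewrite ler1n.
have dp : 0 < d%:R :> R by lra.
have D0 : 0 <= d%:R * `|code (d, u) - code (d, v)| by rewrite mulr_ge0.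
(* Passage from exponent 1 to exponent s, for a relative distance at most 1. *)
have far : `|u - v| <= 36 * (d%:R * `|code (d, u) - code (d, v)|) ->
    `|u - v| <= 36 * (d%:R * `|code (d, u) - code (d, v)|) `^ s.
  move=> /le_trans; apply; rewrite ler_pM2l//.
  have := D0; rewrite le_eqVlt => /orP[/eqP<-|Dp]; first exact: powR_ge0.
  apply: ger1_powR; last exact: ltW.
  rewrite Dp -ler_pdivlMl// mulr1.
  have le p : state p -> 0 < code p < p.1%:R^-1.
    move=> vp; rewrite code_gt0// (lt_le_trans (code_lt vp))//.
    rewrite lef_pV2 ?posrE ?ltr0n ?ler_nat//.
    by case/andP: vp.
  have /= := le _ vu; have /= := le _ vv => h1 h2.
  by rewrite ler_norml; lra.
have [kl|kl|kl] := ltngtP (greedy (d, u)).1 (greedy (d, v)).1.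
- exact/far/code_separation.
- by apply: far; rewrite distrC [in leRHS]distrC; exact: code_separation.
set e := (greedy (d, u)).1 in kl.
pose u' := (greedy (d, u)).2; pose v' := (greedy (d, v)).2.
have su : greedy (d, u) = (e, u') by [].
have sv : greedy (d, v) = (e, v') by rewrite kl.
have vu' : state (e, u') by rewrite -su; exact: state_greedy.
have vv' : state (e, v') by rewrite -sv; exact: state_greedy.
have de : d%:R <= e%:R :> R by rewrite ler_nat ltnW// (greedy_gt (d, u)).
have e2d : e%:R <= 2 * d%:R :> R.
  by rewrite mulr_natl mulr2n -natrD ler_nat (greedy_le vu).
have ep : 0 < e%:R :> R by lra.
have uvE : `|u' - v'| = d%:R * `|u - v|.
  have : (greedy (d, u)).1 = (greedy (d, v)).1 by [].
  rewrite /u' /v' /= => -[/addnI ->].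
  by rewrite -[d%:R in RHS]ger0_norm// -normrM; congr (`|_|); ring.
have cE : `|code (e, u') - code (e, v')|
    = e%:R * `|code (d, u) - code (d, v)|.
  rewrite (codeE vu) (codeE vv) su sv -[(e, u').1]/e -[(e, v').1]/e.
  rewrite -mulrBl normrM [`|e%:R^-1|]ger0_norm ?invr_ge0//.
  by rewrite mulrC divfK ?gt_eqF// distrC; congr (`|_|); ring.
have hn' : 2^-1 ^+ n <= `|u' - v'|.
  rewrite uvE; have d2' : 2 <= d%:R :> R by rewrite ler_nat.
  have := ler_wpM2r (normr_ge0 (u - v)) d2'.
  by move: hn; rewrite exprS; lra.
have e2 : (1 < e)%N by apply: (leq_trans d2); rewrite -(ler_nat R).
have := IH _ _ _ e2 (le_trans dD de) vu' vv' hn'.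
rewrite uvE cE mulrA -expr2; set c := `|code _ - _| => h.
have c0 : 0 <= c by rewrite normr_ge0.
rewrite -(ler_pM2l dp); apply: (le_trans h).
rewrite mulrCA ler_pM2l//.
apply: (@le_trans _ _ ((4 * d%:R * (d%:R * c)) `^ s)).
  apply: ge0_ler_powR; rewrite ?nnegrE ?mulr_ge0 ?exprn_ge0 ?normr_ge0//.
  by rewrite mulrA ler_wpM2r ?normr_ge0//; nra.
rewrite powRM ?mulr_ge0// ler_wpM2r ?powR_ge0// powRM//.
(* The threshold on d is exactly the condition 4 `^ s <= d `^ (1 - s). *)
have h4 : 4 `^ s <= d%:R `^ (1 - s) :> R.
  have -> : s = s / (1 - s) * (1 - s) by field; lra.
  rewrite powRrM mulfVK ?gt_eqF ?subr_gt0//.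
  by apply: ge0_ler_powR => //; rewrite ?nnegrE ?powR_ge0// subr_ge0 ltW.
apply: (le_trans (ler_wpM2r (powR_ge0 _ _) h4)).
by rewrite -powRD ?subrK ?powRr1// oner_eq0.
Qed.

End Coding.

(** * The dimension of the exceptional set *)

Local Open Scope ereal_scope.

Theorem corollary1p17 (R : realType) :
  hausdorff_dim
    [set x : R | irrational_unit x /\
      (limn_esup (fun n : nat => (pierce_lil x n)%:E) <> 1 \/
       limn_einf (fun n : nat => (pierce_lil x n)%:E) <> -1)] = 1.
Proof.
set A := [set x | _].
apply/eqP; rewrite eq_le; apply/andP; split.
  apply/lee_addgt0Pr => e e0; rewrite -EFinD.
  apply: ereal_inf_lbound; exists (1 + e)%R => //=; split.
    by rewrite addr_ge0// ltW.
  apply: hausdorff_measure_gt1_eq0; first by rewrite ltrDl.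
  by move=> x [[/andP[x0 x1] _] _]; rewrite /= in_itv/= x1 ltW.
apply: le_ereal_inf_tmp => _ [s /= [s0 HA] <-].
rewrite lee_fin leNgt; apply/negP => s1; move: HA; apply/eqP.
(* A starting digit beyond the threshold of code_holder, and at least 2. *)
pose d := (Num.truncn ((4 : R) `^ (s / (1 - s)))).+2.
have dD : (4 `^ (s / (1 - s)) <= d%:R :> R)%R.
  by rewrite ltW// (lt_trans (truncnS_gt _))// ltr_nat.
have vd (u : R) : (0 <= u < 1)%R -> state (d, u) by [].
apply: (@hausdorff_measure_neq0 _ _ (fun u => code (d, u)) _ (36 * d%:R `^ s)%R
  s0).
- by rewrite mulr_ge0// powR_ge0.
- move=> u u01; split; first exact/irrational_unit_code/vd.
  left => limsup1; have := limn_esup_pierce_lil_code (vd u u01).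
  by rewrite limsup1 lee_fin ler10.
- move=> u v u01 v01; rewrite -mulrA -powRM//.
  by apply: code_holder => //; rewrite s0 s1.
Qed.
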